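(* Let $\mathcal G=(\mathcal V,\mathcal E_0)$ be a connected undirected graph with $N$ nodes, and let $\mathcal G_c$ be the signed graph with $N+K$ nodes obtained from $\mathcal G$ by adding $K$ collapsing nodes, as described in the context, with node set $\mathcal V_c$ and training set $\mathcal T(\mathcal V_c)$ (the set of original nodes whose labels are known). Assume that every additionally added collapsing node has at least one node in $\mathcal T(\mathcal V_c)$ that shares the same label. Then the number of negative eigenvalues of the signed graph Laplacian $\mathbf L_c\in\mathbb R^{(N+K)\times(N+K)}$ of $\mathcal G_c$ is between $0$ and $\frac{K(K-1)}{2}+K\big(|\mathcal T(\mathcal V_c)|-1\big)$.
   Context: $\mathbf A\in\{0,1\}^{N\times N}$ is the adjacency matrix of $\mathcal G$. $y_i$ denotes the label of node $i$ (known exactly for nodes in the training set) and $\tilde y_k$ the label of collapsing node $k$, $k=1,\dots,K$; the collapsing nodes have different labels and $K$ is the number of classes. The collapsing nodes are additional nodes, connected to the original nodes via $\mathbf C\in\mathbb R^{N\times K}$ with $C_{i,k}=+1$ if $y_i$ is known and $y_i=\tilde y_k$; $C_{i,k}=-1$ if $y_i$ is known and $y_i\ne\tilde y_k$; $C_{i,k}=0$ otherwise. The signed weighted graph $\mathcal G_c$ has adjacency matrix $$\mathbf A_c=\begin{bmatrix}\mathbf A&\mathbf C\\ \mathbf C^\top&\mathbf 0\end{bmatrix},$$ and edge set $\widehat{\mathcal E}=\mathcal E_0\cup\mathcal E_1$, where $\mathcal E_1$ is the set of edges joining nodes with known labels to collapsing nodes. The Laplacian is $\mathbf L_c=\mathbf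 E\mathbf W_c\mathbf E^\top$, where $\mathbf E\in\mathbb R^{(N+K)\times|\widehat{\mathcal E}|}$ is the (oriented) incidence matrix of $\mathcal G_c$ and $\mathbf W_c\in\mathbb R^{|\widehat{\mathcal E}|\times|\widehat{\mathcal E}|}$ is the diagonal matrix of (signed) edge weights. Eigenvalues are counted with multiplicity. *)

(* Defs.v *)
From mathcomp Require Import all_boot all_order all_algebra.
From mathcomp Require Import reals.
From mathcomp.real_closed Require Import polyrcf.

Set Implicit Arguments.
Unset Strict Implicit.
Unset Printing Implicit Defensive.

Import Order.TTheory GRing.Theory Num.Theory.
Local Open Scope ring_scope.

(* Conventions: the original nodes are 'I_N with edge relation e; the label of
   node i is y i, and T is the set of nodes whose label is known; collapsing
   node k : 'I_K has label yt k.  The nodes of the collapsed graph form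
   'I_(N + K): lshift K i is the original node i, and rshift N k is the
   collapsing node k. *)

Definition adjacency_mx (R : nzRingType) (N : nat) (e : rel 'I_N) : 'M[R]_N :=
  \matrix_(i, j) (e i j)%:R.

Definition collapse_mx (R : nzRingType) (N K : nat) (L : finType)
    (y : 'I_N -> L) (T : {set 'I_N}) (yt : 'I_K -> L) : 'M[R]_(N, K) :=
  \matrix_(i, k) (if i \in T then (if y i == yt k then 1 else -1) else 0).

Definition collapsed_adjacency_mx (R : nzRingType) (N K : nat) (L : finType)
    (e : rel 'I_N) (y : 'I_N -> L) (T : {set 'I_N}) (yt : 'I_K -> L) :
    'M[R]_(N + K) :=
  block_mx (adjacency_mx R e) (collapse_mx R y T yt)
           (collapse_mx R y T yt)^T 0.

(* An undirected edge {u, v} is represented once, by the pair (u, v), u < v. *)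
Definition original_edges (N K : nat) (e : rel 'I_N) :
    {set 'I_(N + K) * 'I_(N + K)} :=
  [set (lshift K p.1, lshift K p.2) |
     p : 'I_N * 'I_N & (p.1 < p.2)%N && e p.1 p.2].

Definition collapsing_edges (N K : nat) (T : {set 'I_N}) :
    {set 'I_(N + K) * 'I_(N + K)} :=
  [set (lshift K i, rshift N k) | i in T, k in [set: 'I_K]].

Definition collapsed_edges (N K : nat) (e : rel 'I_N) (T : {set 'I_N}) :
    {set 'I_(N + K) * 'I_(N + K)} :=
  original_edges K e :|: collapsing_edges K T.

(* Incidence matrix of a graph on 'I_n with edge set E, for an arbitrary
   orientation: the edge (u, v) is directed from u to v, unless flip (u, v)
   holds, in which case it is directed from v to u. *)
Definition incidence_mx (R : nzRingType) (n : nat) (E : {set 'I_n * 'I_n})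
    (flip : pred ('I_n * 'I_n)) : 'M[R]_(n, #|E|) :=
  \matrix_(v, a) let p := enum_val a in
    (-1) ^+ flip p * ((v == p.1)%:R - (v == p.2)%:R).

Definition edge_weight_mx (R : nzRingType) (n : nat) (A : 'M[R]_n)
    (E : {set 'I_n * 'I_n}) : 'M[R]_(#|E|) :=
  diag_mx (\row_a A (enum_val a).1 (enum_val a).2).

Definition collapsed_laplacian (R : nzRingType) (N K : nat) (L : finType)
    (e : rel 'I_N) (y : 'I_N -> L) (T : {set 'I_N}) (yt : 'I_K -> L)
    (flip : pred ('I_(N + K) * 'I_(N + K))) : 'M[R]_(N + K) :=
  let E := collapsed_edges K e T in
  incidence_mx R E flip
    *m edge_weight_mx (collapsed_adjacency_mx R e y T yt) E
    *m (incidence_mx R E flip)^T.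

(* rootsR lists the distinct real roots, so each negative eigenvalue is
   weighted by its algebraic multiplicity. *)
Definition num_neg_eigenvalues (R : realType) (n : nat) (M : 'M[R]_n) : nat :=
  (\sum_(x <- rootsR (char_poly M) | (x < 0)%R) mup x (char_poly M))%N.

(* Main.v *)
(* By the spectral theorem over R[i] the Laplacian B W B^T is also P^* D P with
   P unitary and D the diagonal matrix of its eigenvalues, and a Sylvester-type
   dimension count shows that D has at most as many negative entries as W.
   Each training node is joined by a negative edge to the K - 1 collapsing nodes
   with a different label, so there are |T| (K - 1) negative edges.  The
   collapsing nodes having distinct labels, each carried by some training node,
   we have K <= |T|, so that |T| (K - 1) is at most the stated bound. *)
Require Import Defs.
From mathcomp Require Import all_boot all_order all_algebra.
From mathcomp Require Import reals.
From mathcomp Require Import lra.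
From mathcomp.real_closed Require Import polyrcf complex.

Set Implicit Arguments.
Unset Strict Implicit.
Unset Printing Implicit Defensive.

Import Order.TTheory GRing.Theory Num.Theory.
Local Open Scope ring_scope.
Local Open Scope sesquilinear_scope.

Lemma left_kernel_neq0 (F : fieldType) (n p : nat) (M : 'M[F]_(n, p)) :
  (p < n)%N -> exists2 v : 'rV[F]_n, v != 0 & v *m M = 0.
Proof.
move=> ltpn; have /rowV0Pn[v /sub_kermxP vM v0] : kermx M != 0; last by exists v.
by rewrite kermx_eq0 /row_free neq_ltn (leq_ltn_trans (rank_leq_col M)).
Qed.

Lemma diag_mx_formE (C : numClosedFieldType) (n p : nat) (v : 'rV[C]_n)
    (X : 'M[C]_(n, p)) (a : 'rV[C]_p) :
  (v *m (X *m diag_mx a *m X^t*) *m v^t*) 0 0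
  = \sum_i a 0 i * `|(v *m X) 0 i| ^+ 2.
Proof.
have -> : v *m (X *m diag_mx a *m X^t*) *m v^t*
          = (v *m X) *m diag_mx a *m (v *m X)^t*.
  by rewrite trmx_mul map_mxM !mulmxA.
rewrite mul_mx_diag !mxE; apply: eq_bigr => i _.
by rewrite !mxE normCK mulrAC mulrC.
Qed.

Lemma colsub_row_eq0 (F : fieldType) (n p : nat) (v : 'rV[F]_n)
    (X : 'M[F]_(n, p)) (P : pred 'I_p) :
  v *m colsub (@enum_val _ P) X = 0 -> forall i, P i -> (v *m X) 0 i = 0.
Proof.
move=> vX0 i Pi; have /matrixP/(_ 0 (enum_rank_in Pi i)) := vX0.
rewrite mxE [RHS]mxE => vXi; rewrite mxE -[RHS]vXi.
by apply: eq_bigr => j _; rewrite mxE enum_rankK_in.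
Qed.

(* Otherwise, by a dimension count, some v != 0 annihilates the columns of X
   with a nonnegative coefficient and the columns of Y with a negative one; the
   form is then both negative and nonnegative at v. *)
Lemma card_neg_diag_le (C : numClosedFieldType) (n p : nat) (X : 'M[C]_n)
    (a : 'rV[C]_n) (Y : 'M[C]_(n, p)) (b : 'rV[C]_p) :
  X \in unitmx -> a \is a realmx -> b \is a realmx ->
  X *m diag_mx a *m X^t* = Y *m diag_mx b *m Y^t* ->
  (#|[pred i | (a 0 i < 0)%R]| <= #|[pred j | (b 0 j < 0)%R]|)%N.
Proof.
move=> Xu areal breal eqXY; rewrite leqNgt; apply/negP => lt_ba.
pose Pa : pred 'I_n := [pred i | ~~ (a 0 i < 0)].
pose Pb : pred 'I_p := [pred j | b 0 j < 0].
pose M := row_mx (colsub (@enum_val _ Pa) X) (colsub (@enum_val _ Pb) Y).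
have [] := @left_kernel_neq0 _ _ _ M.
  (* [#|Pa|] is [n] minus the number of negative entries of [a], so [lt_ba] leaves [M] fewer than
     [n] columns. *)
  have cardn : (#|[pred i | (a 0 i < 0)%R]| + #|Pa| = n)%N.
    by rewrite -[RHS]card_ord -(cardC [pred i | (a 0 i < 0)%R]).
  by rewrite -[ltnRHS]cardn addnC ltn_add2r.
move=> v v0 /eqP; rewrite mul_mx_row row_mx_eq0 => /andP[/eqP vX /eqP vY].
have vXa := colsub_row_eq0 vX; have vYb := colsub_row_eq0 vY.
(* Strictness comes from the invertibility of [X]: some coordinate of [v *m X] is nonzero, and its
   coefficient must be negative. *)
have w0 : v *m X != 0.
  by apply: contra v0 => /eqP wE; rewrite -(mulmxK Xu v) wE mul0mx.
have [i wi] : exists i, (v *m X) 0 i != 0 by apply/rV0Pn.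
have lt0 : \sum_i a 0 i * `|(v *m X) 0 i| ^+ 2 < 0.
  have term_le0 j : a 0 j * `|(v *m X) 0 j| ^+ 2 <= 0.
    have [aj|aj] := boolP (a 0 j < 0).
      by rewrite mulr_le0_ge0 ?exprn_ge0 // ltW.
    by rewrite vXa // normr0 expr0n mulr0.
  rewrite (bigD1 i) //= ltr_wnDr ?sumr_le0 //.
  rewrite nmulr_rlt0 ?exprn_gt0 ?normr_gt0 //.
  by apply: contraR wi => ai; rewrite vXa.
have ge0 : 0 <= \sum_j b 0 j * `|(v *m Y) 0 j| ^+ 2.
  apply: sumr_ge0 => j _; have [bj|bj] := boolP (b 0 j < 0).
    by rewrite vYb // normr0 expr0n mulr0.
  rewrite mulr_ge0 ?exprn_ge0 // real_leNgt ?real0 //.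
  exact: (mxOverP breal).
move: lt0; rewrite -diag_mx_formE eqXY diag_mx_formE => lt0.
by have := le_lt_trans ge0 lt0; rewrite ltxx.
Qed.

(** The scalar matrix ['X] commutes with constant matrices, so the conjugation passes to
    [char_poly_mx A] and cancels in the determinant. *)
Lemma char_poly_conj (R : comUnitRingType) (n : nat) (P A : 'M[R]_n) :
  P \in unitmx -> char_poly (invmx P *m A *m P) = char_poly A.
Proof.
move=> Pu; pose Q := map_mx polyC P; pose Q' := map_mx polyC (invmx P).
have QQ : Q' *m Q = 1%:M by rewrite -map_mxM mulVmx // map_mx1.
have -> : char_poly (invmx P *m A *m P) = \det (Q' *m char_poly_mx A *m Q).
  rewrite /char_poly; congr (\det _).
  rewrite /char_poly_mx mulmxBr mulmxBl !map_mxM; congr (_ - _).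
  by rewrite scalar_mxC -mulmxA QQ mulmx1.
by rewrite !det_mulmx mulrAC -det_mulmx QQ det1 mul1r.
Qed.

Lemma char_poly_diag (R : comNzRingType) (n : nat) (d : 'rV[R]_n) :
  char_poly (diag_mx d) = \prod_i ('X - (d 0 i)%:P).
Proof.
rewrite char_poly_trig ?diag_mx_is_trig //.
by apply: eq_bigr => i _; rewrite mxE eqxx mulr1n.
Qed.

(** Double counting: the multiplicity of [x] is the number of [i] with [d i = x], and each [d i]
    occurs exactly once in the list of distinct roots. *)
Lemma num_neg_eigenvalues_split (R : realType) (n : nat) (M : 'M[R]_n)
    (d : 'I_n -> R) :
  char_poly M = \prod_i ('X - (d i)%:P) ->
  num_neg_eigenvalues M = #|[pred i | d i < 0]|.
Proof.
move=> cM; rewrite /num_neg_eigenvalues.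
have cM0 : char_poly M != 0 by rewrite monic_neq0 ?char_poly_monic.
have mupE x : mup x (char_poly M) = (\sum_i (d i == x))%N.
  rewrite cM -(big_map d xpredT (fun z => 'X - z%:P)) mu_prod_XsubC count_map.
  by rewrite -sum1_count big_mkcond /=; apply: eq_bigr => i _; case: eqP.
rewrite (eq_bigr _ (fun x _ => mupE x)).
rewrite exchange_big -sum1_card [RHS]big_mkcond /=; apply: eq_bigr => i _.
have di : d i \in rootsR (char_poly M).
  have /(_ (d i)) := roots_on_rootsR cM0.
  rewrite in_itv /= => <-; rewrite cM rootE horner_prod (bigD1 i) //=.
  by rewrite hornerXsubC subrr mul0r.
rewrite inE big_mkcond (bigD1_seq (d i)) ?uniq_roots //= eqxx.
rewrite [X in (_ + X)%N]big1 ?addn0 => [|x /negPf]; first by case: ifP.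
by rewrite eq_sym => ->; case: ifP.
Qed.

Lemma num_neg_eigenvalues_le (R : realType) (n p : nat) (B : 'M[R]_(n, p))
    (w : 'rV[R]_p) :
  (num_neg_eigenvalues (B *m diag_mx w *m B^T) <= #|[pred j | (w 0 j < 0)%R]|)%N.
Proof.
set M := B *m _ *m _; pose toC := real_complex R.
pose MC := map_mx toC M.
have toC_real m q (Z : 'M[R]_(m, q)) : map_mx toC Z \is a realmx.
  by apply/mxOverP => i j; rewrite mxE complex_real.
have MCherm : MC \is hermsymmx.
  apply: realsym_hermsym; last exact: toC_real.
  apply/(is_hermitianmxP false idfun).
  rewrite expr0 scale1r map_mx_id // map_trmx /M !trmx_mul trmxK tr_diag_mx.
  by rewrite mulmxA.
have /orthomx_spectralP := hermitian_normalmx MCherm.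
set P := spectralmx MC; set D := spectral_diag MC => MCE.
have Dreal : D \is a realmx := hermitian_spectral_diag_real MCherm.
have Pu : P \in unitmx := spectral_unit MC.
pose d i := complex.Re (D 0 i).
have dE i : toC (d i) = D 0 i by apply: RRe_real; apply: (mxOverP Dreal).
(* The eigenvalues being real, the complex factorization descends to [R] by injectivity of the
   embedding. *)
have cM : char_poly M = \prod_i ('X - (d i)%:P).
  apply: (map_poly_inj toC); rewrite map_char_poly -/MC MCE char_poly_conj //.
  rewrite char_poly_diag rmorph_prod; apply: eq_bigr => i _.
  by rewrite -dE rmorphB /= map_polyX map_polyC.
rewrite (num_neg_eigenvalues_split cM).
(* Both sides are diagonal forms of [MC]: [P] is unitary, so the adjoint of [invmx P] is [P], and
   [B] is real, so its adjoint is its transpose. *)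
have := @card_neg_diag_le _ _ _ (invmx P) D (map_mx toC B) (map_mx toC w).
rewrite unitmx_inv Pu Dreal toC_real => /(_ isT isT isT).
have -> : (map_mx toC B)^t* = map_mx toC B^T.
  by rewrite -[RHS](realmxC (toC_real _ _ B^T)) map_trmx.
have -> : (invmx P)^t* = P.
  by rewrite invmx_unitary ?spectral_unitarymx // trmxCK.
rewrite -MCE -map_diag_mx -!map_mxM => /(_ erefl).
congr (_ <= _)%N; apply: eq_card => i; rewrite !inE.
  by rewrite -dE -(ltcR (d i)).
by rewrite mxE -(ltcR (w 0 i)).
Qed.

(** Original edges have weight 0 or 1, so a negative edge joins a training node to a collapsing node
    of another label. *)
Lemma card_neg_edges (R : realType) (N K : nat) (L : finType) (e : rel 'I_N)
    (y : 'I_N -> L) (T : {set 'I_N}) (yt : 'I_K -> L) :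
  (#|[pred a : 'I_#|collapsed_edges K e T| |
      (collapsed_adjacency_mx R e y T yt
         (enum_val a).1 (enum_val a).2 < 0)%R]|
   <= #|[set q : 'I_N * 'I_K | (q.1 \in T) && (y q.1 != yt q.2)]|)%N.
Proof.
set E := collapsed_edges K e T; pose f (q : 'I_N * 'I_K) := (lshift K q.1, rshift N q.2).
apply: leq_trans (leq_imset_card f _).
rewrite -(card_imset _ (@enum_val_inj _ (mem E))).
apply: subset_leq_card; apply/subsetP => _ /imsetP[a aneg ->].
move: aneg; rewrite inE; have := enum_valP a.
rewrite {1}/E /collapsed_edges /collapsed_adjacency_mx inE => /orP[].
  case/imsetP => q _ ->; rewrite block_mxEul mxE.
  by rewrite ltNge ler0n.
case/imset2P => i k iT _ ->; rewrite block_mxEur mxE iT.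
case: ifPn => [_|yik _]; first by rewrite ltr10.
by apply/imsetP; exists (i, k); rewrite // inE iT.
Qed.

(** With as many labels as collapsing nodes, [yt] is bijective: each training node matches exactly
    one collapsing node. *)
Lemma card_mismatch (N K : nat) (L : finType) (card_L : #|L| = K)
    (y : 'I_N -> L) (T : {set 'I_N}) (yt : 'I_K -> L) :
  injective yt ->
  #|[set q : 'I_N * 'I_K | (q.1 \in T) && (y q.1 != yt q.2)]| = (#|T| * K.-1)%N.
Proof.
move=> yt_inj; have [g gK Kg] : bijective yt.
  by apply: inj_card_bij yt_inj _; rewrite card_ord card_L.
rewrite -sum1_card.
rewrite (eq_bigl (fun q => (q.1 \in T) && (q.2 != g (y q.1)))); last first.
  by move=> q; rewrite inE -(inj_eq yt_inj) Kg eq_sym.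
rewrite -(pair_big_dep (mem T) (fun i k => k != g (y i)) (fun _ _ => 1%N)) /=.
rewrite -sum_nat_const; apply: eq_bigr => i _.
by rewrite sum1_card cardC1 card_ord.
Qed.

Theorem theorem1 (R : realType) (N K : nat) (e : rel 'I_N)
    (e_sym : symmetric e) (e_irr : irreflexive e)
    (e_conn : forall i j : 'I_N, connect e i j)
    (L : finType) (card_L : #|L| = K)
    (y : 'I_N -> L) (T : {set 'I_N})
    (yt : 'I_K -> L) (yt_inj : injective yt)
    (T_cover : forall k : 'I_K, exists2 i : 'I_N, i \in T & y i = yt k)
    (flip : pred ('I_(N + K) * 'I_(N + K))) :
  (0 : R) <= (num_neg_eigenvalues (collapsed_laplacian R e y T yt flip))%:R
    <= (K%:R * (K%:R - 1) / 2 + K%:R * (#|T|%:R - 1) : R).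
Proof.
rewrite ler0n /=.
set m := num_neg_eigenvalues _.
have m_le : (m <= #|T| * K.-1)%N.
  rewrite -(card_mismatch card_L y T yt_inj).
  apply: leq_trans (card_neg_edges R e y T yt).
  apply: leq_trans (num_neg_eigenvalues_le _ _) _.
  by apply: subset_leq_card; apply/subsetP => a; rewrite !inE mxE.
have K_le : (K <= #|T|)%N.
  have yt_im : codom yt \subset y @: T.
    apply/subsetP => _ /codomP[k ->]; have [i iT <-] := T_cover k.
    exact: imset_f.
  have := leq_trans (subset_leq_card yt_im) (leq_imset_card y T).
  by rewrite card_codom // card_ord.
apply: (@le_trans _ _ (#|T| * K.-1)%:R); first by rewrite ler_nat.
(* For [K = 0] the truncated [K.-1] is 0 and both sides vanish. For [K = k + 1] and [t = #|T|], the
   bound exceeds [t * k] by [k (k + 1) / 2 + (t - (k + 1))], which is nonnegative. *)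
case: {+}K K_le => [|k] K_le; first by rewrite muln0; lra.
have {}K_le : k.+1%:R <= #|T|%:R :> R by rewrite ler_nat.
have := ler0n R k; move: K_le; rewrite natrM -natr1 /=.
by move: (k%:R : R) (#|T|%:R : R) => x t; nra.
Qed.
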